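(* Let $F=F(S)$ be the free group over a set $S$ with $|S|\geq 2$. Let $\varepsilon>0$ and let $G$ be a group with a bi-invariant metric $d$ such that every $\varepsilon$-small subgroup of $G$ is trivial. Let $\sigma\in\ell^\infty(G)$ and $\varepsilon_0:=\|\sigma\|_\infty$. If $0<\varepsilon_0<\frac{\varepsilon}{2}$, then the quasi-morphism $g_\sigma:F\to G$ is non-trivial, in the sense that there is no homomorphism $\varphi:F\to G$ such that $d(g_\sigma,\varphi)\leq\varepsilon_0$.
   Context: A metric $d$ on a group $G$ (with neutral element $e$) is bi-invariant if all left and right translations are isometries. A subgroup $H\leq G$ is $\varepsilon$-small if $H\subset B_\varepsilon(e)$, the open ball of radius $\varepsilon$ around $e$. For maps $f,g:X\to G$ on a set $X$, $d(f,g):=\sup_{x\in X}d(f(x),g(x))$. A map $f:\Gamma\to G$ on a group $\Gamma$ is a quasi-morphism if $\sup_{x,x'\in\Gamma}d(f(xx'),f(x)f(x'))<\infty$. $\ell^\infty(G)$ is the set of bounded sequences $\sigma=(\sigma(k))_{k\geq1}$ in $G$, i.e. $\|\sigma\|_\infty=\sup_k d(\sigma(k),e)<\infty$. Each such $\sigma$ is extended to an odd map $\sigma:\mathbb{Z}\to G$, i.e. $\sigma(-k)=\sigma(k)^{-1}$ and $\sigma(0)=e$. An element $x\in F(S)$ is called a power if $x=s^k$ for some $s\in S$ and $k\in\mathbb{Z}$. Each non-trivial $x\in F$ has a unique shortest factorization into powers, called the factorization of $x$: $x=x_0\cdots x_n$ with $x_i=s_i^{k_i}$, $s_i\in S$,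 $k_i\in\mathbb{Z}\setminus\{0\}$, and $s_i\neq s_{i+1}$ for $0\le i<n$. The map $g_\sigma:F\to G$ is defined on powers by $g_\sigma(s^k)=\sigma(k)$, and for $x$ with factorization $x=x_0\cdots x_n$ by the ordered product $g_\sigma(x)=\prod_{i=0}^n g_\sigma(x_i)=g_\sigma(x_0)\cdots g_\sigma(x_n)$. Each $g_\sigma$ is a quasi-morphism. *)

(* Defs.v *)
From HB Require Import structures.
From mathcomp Require Import all_boot all_order all_algebra.
From mathcomp Require Import zify.
From mathcomp Require Import boolp classical_sets reals ereal topology.
Set Implicit Arguments.
Unset Strict Implicit.
Unset Printing Implicit Defensive.

Import GRing.Theory.
Local Open Scope group_scope.

(* A letter (s, true) stands for s and (s, false) for s^-1; elements of the
   free group are the reduced words in these letters. *)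
Section Words.
Variable S : choiceType.
Local Notation letter := (S * bool)%type.

Definition inv_letter (a : letter) : letter := (a.1, ~~ a.2).

Definition reduced (w : seq letter) : bool :=
  sorted (fun a b => b != inv_letter a) w.

Definition lcons (a : letter) (w : seq letter) : seq letter :=
  if w is b :: w' then if b == inv_letter a then w' else a :: w else [:: a].

Definition wmul (u v : seq letter) : seq letter := foldr lcons v u.

Definition winv (w : seq letter) : seq letter := rev (map inv_letter w).

Lemma inv_letterK : involutive inv_letter.
Proof. by case=> s b; rewrite /inv_letter /= negbK. Qed.

Lemma reduced_lcons a w : reduced w -> reduced (lcons a w).
Proof.
case: w => //= b w; case: eqP => [_|/eqP ba] /=; last by rewrite ba.
by case: w => //= c w /andP[].
Qed.

Lemma reduced_wmul u v : reduced v -> reduced (wmul u v).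
Proof. by move=> rv; elim: u => //= a u; apply: reduced_lcons. Qed.

Lemma reduced_winv w : reduced w -> reduced (winv w).
Proof.
rewrite /reduced /winv rev_sorted sorted_map => /(sub_sorted _); apply.
move=> a b /=; rewrite inv_letterK; apply: contra => /eqP ->.
by [].
Qed.

Lemma lconsK a w : reduced w -> lcons (inv_letter a) (lcons a w) = w.
Proof.
case: w => [|b w] /=; first by rewrite inv_letterK eqxx.
case: eqP => [->|_] /= rw; last by rewrite inv_letterK eqxx.
by case: w rw => //= c w /andP[/negPf ->].
Qed.

Lemma wmul_lcons a u v :
  reduced v -> wmul (lcons a u) v = lcons a (wmul u v).
Proof.
move=> rv; case: u => //= b u; case: eqP => //= ->.
by have := lconsK (inv_letter a) (reduced_wmul u rv); rewrite inv_letterK.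
Qed.

Lemma wmulA u v w : reduced w -> wmul u (wmul v w) = wmul (wmul u v) w.
Proof. by move=> rw; elim: u => //= a u ->; rewrite wmul_lcons. Qed.

Lemma wmul0 u : reduced u -> wmul u [::] = u.
Proof.
elim: u => //= a u IHu ru; have ru' : reduced u by move: ru; case: (u) => //= b v /andP[].
by rewrite IHu //; case: (u) ru => //= b v /andP[/negPf ->].
Qed.

Lemma wmul_rcons u a v : wmul (rcons u a) v = wmul u (lcons a v).
Proof. by rewrite /wmul foldr_rcons. Qed.

Lemma wmulVw w v : reduced v -> wmul (winv w) (wmul w v) = v.
Proof.
move=> rv; elim: w => //= a w IHw.
by rewrite /winv /= rev_cons wmul_rcons lconsK ?reduced_wmul.
Qed.

Lemma winvK : involutive winv.
Proof. by move=> w; rewrite /winv map_rev revK mapK //; apply: inv_letterK. Qed.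

End Words.

Record freeGroup (S : choiceType) : Type :=
  FreeGroup { fword : seq (S * bool); fwordP : reduced fword }.

HB.instance Definition _ (S : choiceType) := [isSub for @fword S].
HB.instance Definition _ (S : choiceType) := [Choice of freeGroup S by <:].

Section FreeGroup.
Variable S : choiceType.
Local Notation F := (freeGroup S).

Definition fg_one : F := @FreeGroup S [::] isT.
Definition fg_mul (x y : F) : F := FreeGroup (reduced_wmul (fword x) (fwordP y)).
Definition fg_inv (x : F) : F := FreeGroup (reduced_winv (fwordP x)).

Lemma fg_mulA : associative fg_mul.
Proof. by move=> x y z; apply/val_inj/wmulA/fwordP. Qed.

Lemma fg_mul1g : left_id fg_one fg_mul.
Proof. by move=> x; apply/val_inj. Qed.

Lemma fg_mulg1 : right_id fg_one fg_mul.
Proof. by move=> x; apply/val_inj/wmul0/fwordP. Qed.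

Lemma fg_mulVg : left_inverse fg_one fg_inv fg_mul.
Proof.
move=> x; apply/val_inj; rewrite /= -[X in wmul _ X]wmul0 ?fwordP //.
exact: wmulVw.
Qed.

Lemma fg_mulgV : right_inverse fg_one fg_inv fg_mul.
Proof.
move=> x; rewrite -{1}(_ : fg_inv (fg_inv x) = x) ?fg_mulVg //.
exact/val_inj/winvK.
Qed.

End FreeGroup.

HB.instance Definition _ (S : choiceType) := isGroup.Build (freeGroup S)
  (@fg_mulA S) (@fg_mul1g S) (@fg_mulg1 S) (@fg_mulVg S) (@fg_mulgV S).

Definition gen (S : choiceType) (s : S) : freeGroup S :=
  @FreeGroup S [:: (s, true)] isT.

Definition zexp (G : groupType) (x : G) (k : int) : G :=
  match k with Posz n => x ^+ n | Negz n => x ^- n.+1 end.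

Section Factorization.
Variable S : choiceType.
Local Notation F := (freeGroup S).

Definition sign (b : bool) : int := if b then 1%R else (-1)%R.

(* Groups consecutive letters with the same underlying generator: the pair
   (s, k) in the output stands for the power s^k. *)
Fixpoint syllables (w : seq (S * bool)) : seq (S * int) :=
  if w is (s, b) :: w' then
    if syllables w' is (t, k) :: f then
      if s == t then (s, sign b + k)%R :: f
      else (s, sign b) :: (t, k) :: f
    else [:: (s, sign b)]
  else [::].

Definition factorization (x : F) : seq (S * int) := syllables (fword x).

Definition eval_powers (l : seq (S * int)) : F :=
  \prod_(p <- l) zexp (gen p.1) p.2.

(* The lemmas factorizationK, factorization_wf and factorization_shortest below
   show that factorization x is the unique shortest factorization of x into
   powers, and that it has the stated form. *)
Definition wf (l : seq (S * int)) : bool :=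
  all (fun p => p.2 != 0%R) l && sorted (fun p q => p.1 != q.1) l.

Lemma wf_cons p l : wf (p :: l) =
  [&& p.2 != 0%R, (if l is q :: _ then p.1 != q.1 else true) & wf l].
Proof. by rewrite /wf /=; case: l => [|q l] /=; do !case: (_ != _) => //=; rewrite ?andbF. Qed.

Lemma reduced_cons (a : S * bool) w : reduced (a :: w) =
  (if w is b :: _ then b != inv_letter a else true) && reduced w.
Proof. by case: w. Qed.

Lemma zexp1D (G : groupType) (x : G) k : zexp x (1 + k)%R = x * zexp x k.
Proof.
case: k => n; first by rewrite [LHS]/= expgS.
case: n => [|n]; first by rewrite /= expg1 mulgV.
rewrite (_ : (1 + Negz n.+1)%R = Negz n) /=; last by lia.
by rewrite [in RHS]expgSr invgM mulgA mulgV mul1g.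
Qed.

Lemma zexpN1D (G : groupType) (x : G) k :
  zexp x (-1 + k)%R = x^-1 * zexp x k.
Proof. by apply: (mulgI x); rewrite -zexp1D addrA subrr add0r mulgA mulgV mul1g. Qed.

Lemma zexpD (G : groupType) (x : G) j k :
  zexp x (j + k)%R = zexp x j * zexp x k.
Proof.
elim/int_rect: j => [|n IH|n IH]; first by rewrite add0r /= mul1g.
  by rewrite -[Posz n.+1]/(1 + n%:Z)%R -addrA !zexp1D IH mulgA.
have -> : (- n.+1%:Z = -1 - n%:Z)%R by lia.
by rewrite -addrA !zexpN1D IH mulgA.
Qed.

Definition lett (a : S * bool) : F := zexp (gen a.1) (sign a.2).

Lemma fword_lett_mul a x : fword (lett a * x) = lcons a (fword x).
Proof. by case: a => s []. Qed.

Lemma fword_prod w : reduced w -> fword (\prod_(a <- w) lett a) = w.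
Proof.
move=> rw; rewrite -[RHS]wmul0 //; elim: w {rw} => [|a w IHw]; first by rewrite big_nil.
by rewrite big_cons fword_lett_mul IHw.
Qed.

Lemma eval_syllables w : eval_powers (syllables w) = \prod_(a <- w) lett a.
Proof.
elim: w => [|[s b] w] /=; first by rewrite /eval_powers !big_nil.
rewrite big_cons => <-; rewrite /eval_powers.
case: syllables => [|[t k] f]; first by rewrite big_cons.
by case: eqP => [->|_]; rewrite !big_cons //= zexpD mulgA.
Qed.

Lemma factorizationK x : eval_powers (factorization x) = x.
Proof. by apply/val_inj; rewrite eval_syllables; apply/fword_prod/fwordP. Qed.

Lemma syllables_cons s b w : syllables ((s, b) :: w) =
  if syllables w is (t, k) :: f then
    if s == t then (s, sign b + k)%R :: f else (s, sign b) :: (t, k) :: f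
  else [:: (s, sign b)].
Proof. by []. Qed.

Lemma syllables_head s b w : reduced ((s, b) :: w) ->
  exists n f, syllables ((s, b) :: w) = (s, sign b * n.+1%:Z)%R :: f.
Proof.
elim: w s b => [|[t c] w IHw] s b; first by exists 0%N, [::]; rewrite /= mulr1.
rewrite reduced_cons => /andP[tc rw]; have [n [f]] := IHw _ _ rw.
rewrite (syllables_cons s) => ->.
case: eqP => [st|_]; last by exists 0%N, ((t, sign c * n.+1%:Z)%R :: f); rewrite mulr1.
exists n.+1, f; move: tc; rewrite /inv_letter /= xpair_eqE st eqxx /=.
move=> bc; congr ((_, _) :: _); have <- : b = c by case: (b) (c) bc => [] [].
by case: (b); rewrite /sign; lia.
Qed.

Lemma factorization_wf x : wf (factorization x).
Proof.
rewrite /factorization; move: (fwordP x); elim: (fword x) => // -[s b] w IHw rw.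
have := syllables_head rw => -[n [f]].
move: rw; rewrite reduced_cons => /andP[_ rw] /=; have := IHw rw.
have sn0 m : (sign b * m.+1%:Z)%R != 0%R by case: (b); rewrite /sign; lia.
have sg0 : sign b != 0%R by case: (b).
case: syllables => [_ _|[t k] g]; first by rewrite wf_cons sg0.
case: eqP => [<-|/eqP st]; last by rewrite (wf_cons (s, _)) sg0 st => ->.
by rewrite !wf_cons /= => /and3P[_ -> ->] [-> _]; rewrite sn0.
Qed.

Definition unsyllables (l : seq (S * int)) : seq (S * bool) :=
  flatten [seq nseq `|p.2|%N (p.1, (0 < p.2)%R) | p <- l].

Lemma syllables_nseq s b n f : (if f is q :: _ then s != q.1 else true) ->
  forall w, syllables w = f ->
  syllables (nseq n.+1 (s, b) ++ w) = (s, sign b * n.+1%:Z)%R :: f.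
Proof.
move=> sf w wf0; elim: n => [|n IHn].
  by rewrite /= wf0 mulr1; case: f sf {wf0} => // -[t k] f /= /negPf ->.
rewrite -[nseq _ _ ++ _]/((s, b) :: (nseq n.+1 (s, b) ++ w)).
rewrite syllables_cons IHn eqxx.
by congr ((_, _) :: _); case: b {IHn}; rewrite /sign; lia.
Qed.

Lemma unsyllables_head p l : wf (p :: l) ->
  exists w, unsyllables (p :: l) = (p.1, (0 < p.2)%R) :: w.
Proof.
rewrite wf_cons => /andP[p0 _]; rewrite /unsyllables /=.
by case: `|p.2|%N (absz_eq0 p.2) p0 => [/esym ->|n _ _] //; eexists.
Qed.

Lemma unsyllablesP l : wf l ->
  reduced (unsyllables l) /\ syllables (unsyllables l) = l.
Proof.
elim: l => [|[s k] l IHl] // wl; have [w Ew] := unsyllables_head wl.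
move: (wl); rewrite wf_cons => /and3P[/= k0 sl wl']; have [rl sK] := IHl wl'.
have [n kn] : exists n, `|k|%N = n.+1.
  by exists `|k|.-1%N; rewrite prednK // absz_gt0.
rewrite /unsyllables /= -/(unsyllables l) kn; split; last first.
  rewrite (@syllables_nseq s _ n l sl _ sK); congr ((_, _) :: _).
  by case: (boolP (0 < k)%R); rewrite /sign; lia.
elim: n {kn Ew} => [|n IHn]; last first.
  by rewrite -[nseq _ _ ++ _]/(_ :: (nseq n.+1 _ ++ _)) reduced_cons IHn andbT
             /inv_letter xpair_eqE eqxx /=; case: (0 < k)%R.
rewrite -[nseq _ _ ++ _]/(_ :: unsyllables l) reduced_cons rl andbT.
case: l sl wl' {wl IHl rl sK} => // q l sq wq.
by have [v ->] := unsyllables_head wq; rewrite xpair_eqE eq_sym /= (negPf sq).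
Qed.

Lemma factorization_uniq l : wf l -> factorization (eval_powers l) = l.
Proof.
move=> /unsyllablesP[rl sK].
by rewrite -{1}sK /factorization eval_syllables fword_prod.
Qed.

Definition push (p : S * int) (l : seq (S * int)) : seq (S * int) :=
  if p.2 == 0%R then l else
  if l is q :: l' then
    if p.1 == q.1 then
      if (p.2 + q.2)%R == 0%R then l' else (p.1, p.2 + q.2)%R :: l'
    else p :: l
  else [:: p].

Lemma push_wf p l : wf l -> wf (push p l).
Proof.
rewrite /push; case: eqP => // /eqP p0; case: l => [|q l]; first by rewrite wf_cons p0.
case: eqP => [pq|/eqP pq wq]; last by rewrite wf_cons p0 pq.
rewrite !wf_cons => /and3P[q0 ql wl]; case: eqP => // /eqP pq0.
by rewrite wf_cons /= pq0 pq ql.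
Qed.

Lemma eval_push p l : eval_powers (push p l) = eval_powers (p :: l).
Proof.
rewrite /eval_powers /push; case: eqP => [p0|_]; first by rewrite big_cons p0 mul1g.
case: l => // q l; case: eqP => // pq; rewrite !big_cons pq mulgA -zexpD.
by case: eqP => [->|_]; rewrite ?big_cons ?mul1g.
Qed.

Lemma size_push p l :
  (size (push p l) <= (size l).+1)%N /\
  (size (push p l) = (size l).+1 -> push p l = p :: l).
Proof.
rewrite /push; case: eqP => _; first by split => [|/eqP]; rewrite ?leqnSn ?(ltn_eqF _).
case: l => [|q l] //=; case: eqP => //= _.
by case: eqP => _ /=; split => //; lia.
Qed.

Lemma factorization_shortest x l : eval_powers l = x ->
  (size (factorization x) <= size l)%N /\
  (size (factorization x) = size l -> factorization x = l).
Proof.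
move=> <-; pose m := foldr push [::] l.
have [wm <-] : wf m /\ eval_powers m = eval_powers l.
  rewrite /m; elim: l {m} => //= p l [wm em]; split; first exact: push_wf.
  by rewrite eval_push /eval_powers !big_cons; congr (_ * _).
rewrite factorization_uniq // /m; elim: l {m wm} => //= p l [le_l eq_l].
have [le_p eq_p] := size_push p (foldr push [::] l).
split; first exact: leq_trans le_p _.
move=> E; have sl : size (foldr push [::] l) = size l by lia.
by rewrite -{2}(eq_l sl); apply: eq_p; rewrite E sl.
Qed.

End Factorization.

(* Since the ball structure of a metricType is by definition the one of mdist,
   a metricGroupType is a group endowed with an arbitrary metric. *)
#[short(type="metricGroupType")]
HB.structure Definition MetricGroup (R : numDomainType) :=
  { G of Group G & Metric R G }.

Local Open Scope classical_set_scope.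

Section MetricGroups.
Variables (R : realType) (G : metricGroupType R).

Definition bi_invariant : Prop :=
  forall a x y : G, mdist (a * x) (a * y) = mdist x y /\
                    mdist (x * a) (y * a) = mdist x y.

Definition is_subgroup (H : set G) : Prop :=
  [/\ H 1%g, forall x y, H x -> H y -> H (x * y) & forall x, H x -> H x^-1].

Definition is_small (eps : R) (H : set G) : Prop :=
  H `<=` ball (1%g : G) eps.

Definition map_dist (X : Type) (f g : X -> G) : \bar R :=
  ereal_sup [set (mdist (f x) (g x))%:E | x in [set: X]].

(* Sequences are indexed by k >= 1: the value at 0 of a function nat -> G is
   never used. *)
Definition supnorm (sigma : nat -> G) : \bar R :=
  ereal_sup [set (mdist (sigma k) 1%g)%:E | k in [set k | (0 < k)%N]].

Definition ell_infty (sigma : nat -> G) : Prop := (supnorm sigma < +oo)%E.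

Definition odd_ext (sigma : nat -> G) (k : int) : G :=
  match k with
  | Posz 0 => 1
  | Posz n.+1 => sigma n.+1
  | Negz n => (sigma n.+1)^-1
  end.

Definition g_map (S : choiceType) (sigma : nat -> G) (x : freeGroup S) : G :=
  \prod_(p <- factorization x) odd_ext sigma p.2.

Lemma g_map_power (S : choiceType) (sigma : nat -> G) (s : S) (k : int) :
  g_map sigma (zexp (gen s) k) = odd_ext sigma k.
Proof.
have [->|k0] := eqVneq k 0%R; first by rewrite /g_map big_nil.
have -> : zexp (gen s) k = eval_powers [:: (s, k)].
  by rewrite /eval_powers big_seq1.
by rewrite /g_map factorization_uniq ?big_seq1 // wf_cons k0.
Qed.

End MetricGroups.

Arguments bi_invariant {R} G.

(* Main.v *)
Require Import Defs.
From mathcomp Require Import all_boot all_order all_algebra.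
From mathcomp Require Import boolp classical_sets reals ereal topology.

(** The values of [phi] on powers of a generator [s] are within [eps0] of values
of [sigma], hence within [2 eps0 < eps] of the identity.  The cyclic group
generated by [phi s] is therefore [eps]-small, so trivial
([small_powers_trivial]), and [phi] itself is trivial
([trivial_on_generators]).

Thus [g_map sigma] would stay within [eps0] of the identity everywhere.  But
alternating two distinct generators prevents any cancellation or merging of
syllables: on the word [s^k t^k s^k ...] with [n] syllables ([alternating]) the
value of [g_map sigma] is exactly [sigma k ^+ n].  So all powers of [sigma k] are
within [eps0 < eps] of the identity, and [small_powers_trivial] applies again:
[sigma k] is trivial for every [k], which contradicts [0 < eps0]. *)

Set Implicit Arguments.
Unset Strict Implicit.
Unset Printing Implicit Defensive.

Import Order.TTheory GRing.Theory Num.Theory.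

Local Open Scope classical_set_scope.
Local Open Scope ring_scope.

Lemma zexpN (G : groupType) (x : G) (k : int) : zexp x (- k) = ((zexp x k)^-1)%g.
Proof. by apply: (mulgI (zexp x k)); rewrite -zexpD subrr mulgV. Qed.

Lemma mdist_invg (R : realType) (G : metricGroupType R) (x : G) :
  bi_invariant G -> mdist 1%g (x^-1)%g = mdist 1%g x.
Proof. by move=> /(_ x 1%g (x^-1)%g) [<- _]; rewrite mulg1 mulgV metric_sym. Qed.

(** Bi-invariance makes inversion preserve the distance to the identity, so that
bounding the nonnegative powers bounds the whole cyclic subgroup. *)
Lemma small_powers_trivial (R : realType) (G : metricGroupType R) (eps : R)
    (x : G) :
  bi_invariant G ->
  (forall H : set G, is_subgroup H -> is_small eps H -> H = [set 1%g]) ->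
  (forall n, mdist 1%g (x ^+ n)%g < eps) -> x = 1%g.
Proof.
move=> hG hsmall hx.
suff H1 : range (zexp x) = [set 1%g].
  have : range (zexp x) x by exists 1.
  by rewrite H1.
apply: hsmall; first split.
- by exists 0.
- by move=> _ _ [j _ <-] [k _ <-]; exists (j + k) => //; rewrite zexpD.
- by move=> _ [k _ <-]; exists (- k) => //; rewrite zexpN.
move=> _ [k _ <-]; rewrite ballEmdist /=.
by case: k => n /=; rewrite ?mdist_invg.
Qed.

Lemma multiplicative1 (G H : groupType) (f : {multiplicative G -> H}) :
  f 1%g = 1%g.
Proof. by apply: (mulgI (f 1%g)); rewrite -gmulfM !mulg1. Qed.

Lemma multiplicativeX (G H : groupType) (f : {multiplicative G -> H}) x n :
  f (x ^+ n)%g = (f x ^+ n)%g.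
Proof.
by elim: n => [|n IHn]; [exact: multiplicative1 | rewrite !expgS gmulfM IHn].
Qed.

Lemma trivial_on_generators (S : choiceType) (G : groupType)
    (f : {multiplicative freeGroup S -> G}) :
  (forall s, f (gen s) = 1%g) -> forall x, f x = 1%g.
Proof.
move=> fgen x; rewrite -(factorizationK x) /eval_powers.
elim: (factorization x) => [|[s k] l IHl]; first by rewrite big_nil multiplicative1.
rewrite big_cons gmulfM IHl mulg1.
have fX n : f (gen s ^+ n)%g = 1%g by rewrite multiplicativeX fgen expg1n.
case: k => n; first exact: fX.
apply: (mulgI (f (gen s ^+ n.+1)%g)).
by rewrite -gmulfM mulgV multiplicative1 fX mulg1.
Qed.

Fixpoint alternating (S : choiceType) (s t : S) (k : int) (n : nat) :
    seq (S * int) :=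
  if n is n'.+1 then (s, k) :: alternating t s k n' else [::].

(** Consecutive syllables are powers of distinct generators, so the word is its
own factorization. *)
Lemma wf_alternating (S : choiceType) (s t : S) (k : int) n :
  s != t -> k != 0 -> wf (alternating s t k n).
Proof.
move=> st k0; elim: n s t st => // n IHn s t st.
rewrite [alternating _ _ _ _]/= wf_cons k0 IHn 1?eq_sym // andbT /=.
by case: n {IHn}.
Qed.

(** [g_map sigma] does not see which generator carries a syllable, only its
exponent, hence [n] equal factors. *)
Lemma g_map_alternating (R : realType) (G : metricGroupType R) (S : choiceType)
    (sigma : nat -> G) (s t : S) (k : int) n :
  s != t -> k != 0 ->
  g_map sigma (eval_powers (alternating s t k n)) = (odd_ext sigma k ^+ n)%g.
Proof.
move=> st k0; rewrite /g_map factorization_uniq ?wf_alternating //.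
elim: n s t st => [|n IHn] s t st; first by rewrite big_nil.
by rewrite big_cons IHn 1?eq_sym // expgS.
Qed.

Lemma map_dist_le (R : realType) (G : metricGroupType R) (X : Type)
    (f g : X -> G) (r : R) :
  (map_dist f g <= r%:E)%E -> forall x, mdist (f x) (g x) <= r.
Proof.
move=> fgr x; rewrite -lee_fin; apply: le_trans fgr.
by apply: ereal_sup_ubound; exists x.
Qed.

Lemma supnorm_ge (R : realType) (G : metricGroupType R) (sigma : nat -> G) k :
  (0 < k)%N -> ((mdist 1%g (sigma k))%:E <= supnorm sigma)%E.
Proof.
by move=> k0; apply: ereal_sup_ubound; exists k => //; rewrite metric_sym.
Qed.

Lemma supnorm_le0 (R : realType) (G : metricGroupType R) (sigma : nat -> G) :
  (forall k, (0 < k)%N -> sigma k = 1%g) -> (supnorm sigma <= 0)%E.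
Proof.
by move=> s1; apply: ge_ereal_sup => _ [k /s1 -> <-]; rewrite mdistxx.
Qed.

Theorem proposition5p2
  (S : choiceType) (hS : exists s t : S, s <> t)
  (R : realType) (eps : R) (heps : 0 < eps)
  (G : metricGroupType R) (hG : bi_invariant G)
  (hsmall : forall H : set G,
     is_subgroup H -> is_small eps H -> H = [set 1%g])
  (sigma : nat -> G) (hsigma : ell_infty sigma)
  (eps0 : R) (heps0 : eps0%:E = supnorm sigma)
  (eps0_gt0 : 0 < eps0) (eps0_lt : eps0 < eps / 2) :
  ~ exists phi : {multiplicative freeGroup S -> G},
      (map_dist (g_map sigma : freeGroup S -> G) phi <= eps0%:E)%E.
Proof.
move=> [phi /map_dist_le g_phi]; have [s [t /eqP st]] := hS.
have eps0D : eps0 + eps0 < eps by rewrite [ltRHS]splitr ltrD.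
have phi1 : forall x, phi x = 1%g.
  apply: trivial_on_generators => u; apply: (small_powers_trivial hG hsmall) => n.
  apply: le_lt_trans eps0D.
  (* Both [1] and [phi (gen u ^+ n)] are within [eps0] of [odd_ext sigma n]. *)
  apply: le_trans (metric_triangle _ (odd_ext sigma n) _) _; apply: lerD.
    case: n => [|n]; first by rewrite mdistxx ltW.
    by rewrite -lee_fin heps0 supnorm_ge.
  by rewrite -(g_map_power sigma u) -multiplicativeX g_phi.
have sigma1 k : (0 < k)%N -> sigma k = 1%g.
  case: k => // k _; apply: (small_powers_trivial hG hsmall) => n.
  have := g_phi (eval_powers (alternating s t k.+1 n)).
  rewrite phi1 g_map_alternating // metric_sym => /le_lt_trans; apply.
  by apply: lt_trans eps0D; rewrite ltrDl.
have := supnorm_le0 sigma1.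
by rewrite -heps0 lee_fin leNgt eps0_gt0.
Qed.
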